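(* Let $\mathcal{A}$ be a commuting family of power bounded $n\times n$ complex matrices and let $\mathcal{F}\subset\mathcal{A}$ be a finite subset. Then there exists an invertible $n\times n$ complex matrix $Y$ with the property that $YTY^{-1}$ is a contraction for every $T\in\mathcal{F}$. Moreover, we have $$\|Y\|=\|Y^{-1}\|\leq\alpha\left(\frac{n^2K}{1-r}\right)^{\frac{n-1}{2}},$$ where $\alpha\geq 1$ is a constant depending only on $\mathcal{A}$ (and not on the finite subset $\mathcal{F}$), $$K=\max_{T\in\mathcal{F}}\|T\|\quad\text{and}\quad r=\max_{T\in\mathcal{F}}\max_{\lambda\in\Delta(T)}|\lambda|.$$
   Context: Here $n$ is a positive integer. The norm of an $n\times n$ complex matrix is its operator norm on the Hilbert space $\mathbb{C}^n$ (Euclidean norm); a contraction is a matrix of norm at most $1$. A family is commuting if any two of its elements commute; the family $\mathcal{A}$ may be infinite. A matrix $T$ is power bounded if there is a constant $C>0$ (possibly depending on $T$) with $\|T^p\|\leq C$ for every positive integer $p$. For a matrix $T$, $\Delta(T)$ denotes the set of eigenvalues $\lambda$ of $T$ that appear in a Jordan block of size at least $2$ in the Jordan canonical form of $T$; equivalently, the eigenvalues $\lambda$ with $\ker(T-\lambda I)\neq\ker(T-\lambda I)^2$. For power bounded $T$ one has $\Delta(T)\subset\{z\in\mathbb{C}:|z|<1\}$. The maximum of the empty set is $0$ by convention.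
   Formalization: The printed bound fails for n ≥ 2 if F is empty, F = {0}, or A has arbitrarily small norms; it is proved for nonempty F when norms in A are bounded below by a positive constant, and in general with max(1, n²K/(1−r)) in place of n²K/(1−r). *)

(* Defs.v *)
From HB Require Import structures.
From mathcomp Require Import all_boot all_order all_algebra.
From mathcomp Require Import finmap.
From mathcomp Require Import all_classical all_reals all_analysis.
From mathcomp Require Export complex.

Set Implicit Arguments.
Unset Strict Implicit.
Unset Printing Implicit Defensive.

Import Order.TTheory GRing.Theory Num.Theory.

Local Open Scope classical_set_scope.
Local Open Scope ring_scope.
Local Open Scope complex_scope.

(* [ComplexField.Normc.normc : R[i] -> R] is the modulus with values in R,
   whereas [`|z|] for [z : R[i]] lies in R[i]. *)
Notation modulus := ComplexField.Normc.normc.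

Definition l2norm (R : realType) (n : nat) (v : 'cV[R[i]]_n) : R :=
  Num.sqrt (\sum_(i < n) modulus (v i 0) ^+ 2).

Definition opnorm (R : realType) (n : nat) (T : 'M[R[i]]_n) : R :=
  sup [set l2norm (T *m v) | v in [set v : 'cV[R[i]]_n | l2norm v <= 1]].

Definition mx_contraction (R : realType) (n : nat) (T : 'M[R[i]]_n) : Prop :=
  opnorm T <= 1.

Definition power_bounded (R : realType) (n : nat) (T : 'M[R[i]]_n) : Prop :=
  exists2 C : R, 0 < C & forall p : nat, (0 < p)%N -> opnorm (T ^+ p) <= C.

Definition commuting (R : realType) (n : nat) (A : set 'M[R[i]]_n) : Prop :=
  forall S T, A S -> A T -> S *m T = T *m S.

Definition kernel_of (R : realType) (n : nat) (T : 'M[R[i]]_n) :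
    set 'cV[R[i]]_n :=
  [set v | T *m v = 0].

(* The eigenvalues having a Jordan block of size at least 2. *)
Definition Delta (R : realType) (n : nat) (T : 'M[R[i]]_n) : set R[i] :=
  [set l | eigenvalue T l /\
           kernel_of (T - l%:M) <> kernel_of ((T - l%:M) ^+ 2)].

(* [fset_set] is [fset0] on infinite sets, hence the need for this fact. *)
Lemma finite_Delta (R : realType) (n : nat) (T : 'M[R[i]]_n) :
  finite_set (Delta T).
Proof.
have [rs Hrs] := closed_field_poly_normal (char_poly T).
apply: (@sub_finite_set _ _ [set` rs]); last exact: finite_seq.
move=> l [Hl _]; move: Hl; rewrite eigenvalue_root_char Hrs.
by rewrite (monicP (char_poly_monic T)) scale1r root_prod_XsubC.
Qed.

Definition max_norm (R : realType) (n : nat) (F : {fset 'M[R[i]]_n}) : R :=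
  \big[Num.max/0]_(T <- F) opnorm T.

Definition max_Delta (R : realType) (n : nat) (F : {fset 'M[R[i]]_n}) : R :=
  \big[Num.max/0]_(T <- F) \big[Num.max/0]_(l <- fset_set (Delta T)) modulus l.

Definition similarity_ratio (R : realType) (n : nat)
    (F : {fset 'M[R[i]]_n}) : R :=
  n%:R ^+ 2 * max_norm F / (1 - max_Delta F).

(* Since |Y| = |Y^-1| forces |Y| >= 1, for n > 1 no bound
   |Y| <= alpha * (n^2 K / (1-r))^((n-1)/2) can hold if F is empty or F = {0},
   nor with alpha uniform in F if A has elements of arbitrarily small norm
   (e.g. all multiples e I with 0 < e <= 1).  The next condition on A, together
   with F nonempty, is exactly what excludes this. *)
Definition norms_bounded_below (R : realType) (n : nat)
    (A : set 'M[R[i]]_n) : Prop :=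
  exists2 delta : R, 0 < delta & forall T, A T -> delta <= opnorm T.

(* Main.v *)
Require Import Defs.
From mathcomp Require Import all_boot all_order all_algebra.
From mathcomp Require Import finmap.
From mathcomp Require Import all_classical all_reals all_analysis.
From mathcomp Require Import complex ring.

(** One similarity [S], depending only on the commuting family, splits the space
    into joint generalized eigenspaces and makes every [T] lower triangular in
    each of them: [S T S^-1 = U], where an off-diagonal entry [U i j] can be
    nonzero only if [U i i = U j j], and this common value then lies in
    [Delta T], hence has modulus at most [r < 1].  Conjugating [U] by
    [diag(1, e, ..., e^(n-1))] multiplies the entries below the diagonal by at
    most [e]; for [e] of order [(1 - r) / (n^2 K)] all row and column sums of
    moduli are at most [1], so that the Schur test gives a contraction.  The
    price is a factor [e^-(n-1)] in [|Y| |Y^-1|], and rescaling [Y] so that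
    [|Y| = |Y^-1|] halves the exponent. *)

Set Implicit Arguments.
Unset Strict Implicit.
Unset Printing Implicit Defensive.

Import Order.TTheory GRing.Theory Num.Theory.

Local Open Scope classical_set_scope.
Local Open Scope ring_scope.
Local Open Scope complex_scope.

(** * Simultaneous block triangularization *)

(** Serves two extremal choices below: an exponent for which a rank is minimal, and a proper
    invariant subspace of maximal rank. *)
Lemma exists_argmin (T : Type) (P : T -> Prop) (f : T -> nat) :
  (exists x, P x) -> exists2 x, P x & forall y, P y -> (f x <= f y)%N.
Proof.
move=> [x0 Px0]; pose Q := [pred m | `[< exists2 x, P x & f x = m >]].
have exQ : exists m, Q m by exists (f x0); apply/asboolP; exists x0.
have [m /asboolP[x Px <-] minm] := ex_minnP exQ.
by exists x => // y Py; apply: minm; apply/asboolP; exists y.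
Qed.

Lemma stablemxX (F : fieldType) (m n : nat) (B : 'M[F]_(m, n)) (N : 'M[F]_n)
  (p : nat) : stablemx B N -> stablemx B (N ^+ p).
Proof.
move=> sBN; elim: p => [|p IHp]; first by rewrite expr0 -idmxE mulmx1.
by rewrite exprS -mulmxE stablemxM.
Qed.

(** Subspaces are row spaces and matrices act on the right. Once the rank of [B *m N ^+ p.+1] is
    minimal, [N ^+ p.+1] is injective on this image; hence the image meets the kernel trivially, and
    rank-nullity makes their sum all of [B]. *)
Lemma fitting_decomposition (F : fieldType) (n : nat) (B N : 'M[F]_n) :
  stablemx B N ->
  exists p : nat, ((B :&: kermx (N ^+ p.+1)) :&: (B *m N ^+ p.+1))%MS = 0 /\
                  ((B :&: kermx (N ^+ p.+1)) + (B *m N ^+ p.+1) :=: B)%MS.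
Proof.
move=> sBN; have [|p _ minp] :=
  @exists_argmin nat (fun=> True) (fun p => \rank (B *m N ^+ p.+1)).
  by exists 0%N.
exists p; set M := N ^+ p.+1.
have dker : ((B *m M) :&: kermx M)%MS = 0.
  have := mxrank_mul_ker (B *m M) M; rewrite -mulmxA mulmxE -exprD addSn.
  have := minp (p + p.+1)%N I; rewrite -/M => le_rank eq_rank.
  apply/eqP; rewrite -mxrank_eq0 -leqn0 -(leq_add2l (\rank (B *m M))) addn0.
  by rewrite -[X in (_ <= X)%N]eq_rank leq_add2r.
have dBB : ((B :&: kermx M) :&: (B *m M))%MS = 0.
  apply/eqP; rewrite -submx0 -dker sub_capmx capmxSr /=.
  by rewrite (submx_trans (capmxSl _ _)) // capmxSr.
split=> //; apply/eqmxP; rewrite -(geq_leqif (mxrank_leqif_eq _)); last first.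
  by rewrite addsmx_sub capmxSl stablemxX.
by rewrite mxrank_disjoint_sum // addnC mxrank_mul_ker.
Qed.

(** The restriction of [X] to a basis of [B] has an eigenvector over an algebraically closed field;
    its coordinates are mapped back to the ambient space. *)
Lemma stable_eigenvector (C : numClosedFieldType) (n : nat) (B X : 'M[C]_n) :
  stablemx B X -> B != 0 ->
  exists l : C, (B :&: kermx (X - l%:M))%MS != 0.
Proof.
move=> sBX nzB; have [|l] := @eigenvalue_closed C _ (restrictmx B X).
  by rewrite lt0n mxrank_eq0.
rewrite /eigenvalue; case/eigenvalueP=> v vX nzv; exists l.
have : (v <= eigenspace (restrictmx B X) l)%MS by apply/eigenspaceP.
rewrite sub_eigenspace_conjmx ?stablemx_row_base ?row_base_free // => vBX.
have nzvB : v *m row_base B != 0 by rewrite mulmx_free_eq0 ?row_base_free.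
apply: contraNneq nzvB => cap0; rewrite -submx0 -cap0 sub_capmx vBX andbT.
by rewrite mulmx_sub ?eq_row_base.
Qed.

(** The splitting into generalized eigenspaces is encoded by entries instead of block sizes, so that
    one basis can serve a whole family although the coincidences among eigenvalues vary with the
    matrix. *)
Definition block_triangular (F : fieldType) (k : nat) (U : 'M[F]_k) :=
  is_trig_mx U /\ forall i j, U i j != 0 -> U i i = U j j.

Lemma block_triangular_block_mx (F : fieldType) (k1 k2 : nat)
    (U1 : 'M[F]_k1) (U2 : 'M[F]_k2) (W : 'M[F]_(k2, k1)) :
  block_triangular U1 -> block_triangular U2 ->
  (forall i j, W i j != 0 -> U2 i i = U1 j j) ->
  block_triangular (block_mx U1 0 W U2).
Proof.
move=> [t1 b1] [t2 b2] bW; split; first by rewrite is_trig_block_mx // eqxx t1.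
move=> i j; case: (split_ordP i) => i' ->; case: (split_ordP j) => j' ->;
  rewrite ?block_mxEul ?block_mxEur ?block_mxEdl ?block_mxEdr ?mxE ?eqxx //.
- exact: b1.
- exact: bW.
- exact: b2.
Qed.

Lemma trig_mx_eigenvalue (F : fieldType) (k : nat) (U : 'M[F]_k) (i : 'I_k) :
  is_trig_mx U -> eigenvalue U (U i i).
Proof.
move=> tU; rewrite eigenvalue_root_char char_poly_trig // (bigD1 i) //=.
by rewrite rootM root_XsubC eqxx.
Qed.

(** If [v] is an eigenvector of [U] for [U i i], then [v *m S] is nonzero and [X - l%:M] multiplies
    it by [U i i - l]; nilpotency forces this scalar to vanish. *)
Lemma trig_mx_diag_nilpotent (F : fieldType) (k n p : nat) (S : 'M[F]_(k, n))
    (X : 'M[F]_n) (U : 'M[F]_k) (l : F) :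
  row_free S -> S *m X = U *m S -> is_trig_mx U ->
  S *m (X - l%:M) ^+ p = 0 -> forall i, U i i = l.
Proof.
move=> fS SX tU S0 i; have /eigenvalueP[v vU nzv] := trig_mx_eigenvalue i tU.
apply/eqP; rewrite -subr_eq0; have vSp q :
    v *m S *m (X - l%:M) ^+ q = (U i i - l) ^+ q *: (v *m S).
  elim: q => [|q IHq]; first by rewrite !expr0 -idmxE mulmx1 scale1r.
  rewrite exprSr -mulmxE mulmxA IHq -scalemxAl mulmxBr -mulmxA SX mulmxA vU.
  by rewrite mul_mx_scalar -scalemxAl -scalerBl scalerA -exprSr.
have := vSp p; rewrite -mulmxA S0 mulmx0 => /esym/eqP.
by rewrite scaler_eq0 mulmx_free_eq0 // (negPf nzv) orbF expf_eq0 => /andP[].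
Qed.

(** Induction on the rank of [B]. If [B] is a direct sum of two nonzero invariant subspaces, their
    bases are stacked. Otherwise each [X] has a single eigenvalue on [B], and a basis of a maximal
    proper invariant subspace is extended by a basis of a complement. *)
Lemma stable_triangular_basis (C : numClosedFieldType) (n : nat)
    (A : set 'M[C]_n) :
  (forall X Y, A X -> A Y -> X *m Y = Y *m X) ->
  forall B : 'M[C]_n, (forall X, A X -> stablemx B X) ->
  exists (k : nat) (S : 'M[C]_(k, n)),
    [/\ row_free S, (S :=: B)%MS &
        forall X, A X -> exists2 U, S *m X = U *m S & block_triangular U].
Proof.
move=> comA B; have [r ltBr] := ubnP (\rank B).
elim: r => // r IHr in B ltBr * => sB.
have [->|nzB] := eqVneq B 0.
  exists 0%N, 0; split; first by rewrite /row_free mxrank0.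
  - by apply/eqmxP; rewrite !sub0mx.
  - move=> X _; exists 0; first by rewrite !mul0mx.
    by split=> [|[]//]; apply/is_trig_mxP=> -[].
have [[B1 [B2 [sB1 sB2 nz1 [nz2 cap0 eqB]]]]|indecB] := pselect
  (exists B1 B2 : 'M[C]_n,
    [/\ forall X, A X -> stablemx B1 X, forall X, A X -> stablemx B2 X,
        B1 != 0 & [/\ B2 != 0, (B1 :&: B2)%MS = 0 & (B1 + B2 :=: B)%MS]]).
  have rB : (\rank B1 + \rank B2 = \rank B)%N.
    by rewrite -mxrank_disjoint_sum // eqB.
  have lt1 : (\rank B1 < r)%N.
    rewrite -ltnS (leq_trans _ ltBr) // ltnS -rB.
    by rewrite -[X in (X < _)%N]addn0 ltn_add2l lt0n mxrank_eq0.
  have lt2 : (\rank B2 < r)%N.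
    rewrite -ltnS (leq_trans _ ltBr) // ltnS -rB.
    by rewrite -[X in (X < _)%N]add0n ltn_add2r lt0n mxrank_eq0.
  have [k1 [S1 [f1 e1 a1]]] := IHr _ lt1 sB1.
  have [k2 [S2 [f2 e2 a2]]] := IHr _ lt2 sB2.
  exists (k1 + k2)%N, (col_mx S1 S2).
  have eS : (col_mx S1 S2 :=: B)%MS.
    apply: eqmx_trans (eqmx_sym (addsmxE _ _)) _.
    exact: eqmx_trans (adds_eqmx e1 e2) eqB.
  split=> // [|X AX].
    by rewrite /row_free eS -rB -e1 -e2 (eqP f1) (eqP f2).
  have [U1 SX1 b1] := a1 X AX; have [U2 SX2 b2] := a2 X AX.
  exists (block_mx U1 0 0 U2).
    by rewrite mul_col_mx mul_block_col SX1 SX2 !mul0mx addr0 add0r.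
  by apply: block_triangular_block_mx => // i j; rewrite mxE eqxx.
(* By indecomposability, the Fitting decomposition of [B] under [X - l] is
   trivial. *)
have nilX X : A X -> exists l p, B *m (X - l%:M) ^+ p = 0.
  move=> AX; have [l nzK] := stable_eigenvector (sB X AX) nzB.
  exists l; set N := X - l%:M; have sBN : stablemx B N.
    by rewrite /N stablemxD ?stablemxN ?stablemxC // sB.
  have comN Y p : A Y -> N ^+ p *m Y = Y *m N ^+ p.
    move=> AY; have cNY : GRing.comm Y N.
      rewrite /GRing.comm /N -!mulmxE mulmxBl mulmxBr comA //.
      by rewrite scalar_mxC.
    by rewrite !mulmxE -(commrX p cNY).
  have [p [cap0 eqB]] := fitting_decomposition sBN.
  exists p.+1; apply: contrapT => /eqP nzBN; apply: indecB.
  exists (B :&: kermx (N ^+ p.+1))%MS, (B *m N ^+ p.+1).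
  split=> // [Y AY|Y AY|].
  - rewrite sub_capmx (submx_trans _ (sB Y AY)) ?submxMr ?capmxSl //=.
    apply/sub_kermxP; rewrite -mulmxA -comN // mulmxA.
    by rewrite (sub_kermxP (capmxSr _ _)) mul0mx.
  - by rewrite -mulmxA comN // mulmxA submxMr // sB.
  (* The exponent is positive, so this summand contains the eigenvectors of [X] for [l] that lie in
     [B]. *)
  - apply: contraNneq nzK => K0; rewrite -submx0 -K0 capmxS //.
    by apply/sub_kermxP; rewrite exprS -mulmxE mulmxA mulmx_ker mul0mx.
(* A maximal proper invariant subspace [H] contains every [B (X - l)]: else
   [B = H + B (X - l)], and iterating gives [B = H + B (X - l)^p = H]. *)
have [|H [sH HB nBH] maxH] := @exists_argmin 'M[C]_n
    (fun H => [/\ forall X, A X -> stablemx H X, (H <= B)%MS & ~~ (B <= H)%MS])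
    (fun H => n - \rank H)%N.
  by exists 0; rewrite sub0mx submx0; split=> // X _; rewrite mul0mx sub0mx.
have ltHr : (\rank H < r)%N.
  rewrite -ltnS (leq_trans _ ltBr) // ltnS ltn_neqAle mxrankS // andbT.
  by rewrite (mxrank_leqif_sup HB).
have [k1 [S1 [f1 e1 a1]]] := IHr _ ltHr sH.
pose S2 := row_base (B :\: H)%MS.
have rB : (\rank H + \rank (B :\: H) = \rank B)%N.
  by rewrite -(mxrank_cap_compl B H) (capmx_idPr HB).
have eS : (col_mx S1 S2 :=: B)%MS.
  apply: eqmx_trans (eqmx_sym (addsmxE _ _)) _.
  apply: eqmx_trans (adds_eqmx e1 (eq_row_base _)) _.
  rewrite addsmxC.
  apply: eqmx_trans _ (addsmx_diff_cap_eq B H).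
  by apply: adds_eqmx => //; apply/eqmx_sym/capmx_idPr.
exists (k1 + \rank (B :\: H))%N, (col_mx S1 S2); split=> // [|X AX].
  by rewrite /row_free eS -rB -e1 (eqP f1).
have [U1 SX1 b1] := a1 X AX; have [l [p BN0]] := nilX X AX.
pose N : 'M[C]_n := X - l%:M; rewrite -/N in BN0.
have sN V : (forall X, A X -> stablemx V X) -> stablemx V N.
  by move=> sV; rewrite /N stablemxD ?stablemxN ?stablemxC // sV.
have comN Y : A Y -> N *m Y = Y *m N.
  by move=> AY; rewrite /N mulmxBl mulmxBr comA // scalar_mxC.
have BNH : (B *m N <= H)%MS.
  suff nBH' : ~~ (B <= H + B *m N)%MS.
    have /maxH le_rank : [/\ forall Y, A Y -> stablemx (H + B *m N)%MS Y,
        (H + B *m N <= B)%MS & ~~ (B <= H + B *m N)%MS].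
      split=> // [Y AY|]; last by rewrite addsmx_sub HB sN.
      by rewrite stableDmx ?sH // -mulmxA comN // mulmxA submxMr // sB.
    have : (\rank (H + B *m N) <= \rank H)%N.
      by rewrite -(leq_sub2lE _ (rank_leq_col _)).
    rewrite (geq_leqif (mxrank_leqif_sup (addsmxSl H (B *m N)))).
    by apply: submx_trans; apply: addsmxSr.
  apply: contra nBH => BHN; suff /(_ p) : forall q, (B <= H + B *m N ^+ q)%MS.
    by rewrite BN0 addsmx0_id.
  elim=> [|q IHq]; first by rewrite expr0 -idmxE mulmx1 addsmxSr.
  apply: submx_trans BHN _; rewrite addsmx_sub addsmxSl /=.
  apply: submx_trans (submxMr N IHq) _; rewrite addsmxMr exprSr mulmxA.
  by rewrite addsmxS // sN.
have S1B : (S1 <= B)%MS by rewrite e1.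
have diagU1 i : U1 i i = l.
  apply: (trig_mx_diag_nilpotent f1 SX1 b1.1 (p := p)).
  by have /submxP[D ->] := S1B; rewrite -mulmxA BN0 mulmx0.
(* Since [B *m N] lies in [H], the new rows satisfy [S2 *m X = W *m S1 + l *: S2]: the lower right
   block is scalar. *)
have /submxP[W SW] : (S2 *m N <= S1)%MS.
  rewrite e1 (submx_trans _ BNH) // submxMr // eq_row_base diffmxSl //.
exists (block_mx U1 0 W l%:M).
  rewrite mul_col_mx mul_block_col SX1 mul0mx addr0 -SW mulmxBr.
  by rewrite mul_mx_scalar mul_scalar_mx subrK.
apply: block_triangular_block_mx => //.
  split=> [|i j]; first exact: scalar_mx_is_trig.
  by rewrite !mxE !eqxx.
by move=> i j _; rewrite mxE eqxx diagU1.
Qed.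

Lemma similar_eigenvalue (F : fieldType) (n : nat) (T S U : 'M[F]_n) (l : F) :
  S \in unitmx -> S *m T = U *m S -> eigenvalue U l -> eigenvalue T l.
Proof.
move=> uS ST /eigenvalueP[v vU nzv]; apply/eigenvalueP; exists (v *m S).
  by rewrite -mulmxA ST mulmxA vU scalemxAl.
by rewrite mulmx_free_eq0 // row_free_unit.
Qed.

(** If [T - l%:M] and its square had the same kernel, so would [M = U - l%:M] and its square, and
    every vector killed by a power of [M] would be killed by [M]. But a power of [M] kills
    [delta_mx j 0], while [M *m delta_mx j 0] has the nonzero coordinate [U i j]. *)
Lemma off_diag_Delta (R : realType) (n : nat) (T S U : 'M[R[i]]_n)
    (i j : 'I_n) :
  S \in unitmx -> S *m T = U *m S -> block_triangular U ->
  i != j -> U i j != 0 -> Delta T (U i i).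
Proof.
move=> uS ST [tU bU] neq_ij Uij; set l := U i i; split.
  exact: similar_eigenvalue uS ST (trig_mx_eigenvalue i tU).
move=> eqK; pose M : 'M[R[i]]_n := U - l%:M.
have TM : (T - l%:M) *m invmx S = invmx S *m M.
  rewrite mulmxBl mulmxBr -scalar_mxC; congr (_ - _).
  by rewrite -[T in LHS](mulKmx uS) ST mulmxA mulmxK.
have kerM (v : 'cV_n) : M *m (M *m v) = 0 -> M *m v = 0.
  move=> MMv; have : kernel_of ((T - l%:M) ^+ 2) (invmx S *m v).
    rewrite /kernel_of /= expr2 -mulmxE -mulmxA [X in _ *m X]mulmxA TM.
    by rewrite -[X in _ *m X]mulmxA mulmxA TM -mulmxA MMv mulmx0.
  rewrite -eqK /kernel_of /= mulmxA TM -mulmxA.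
  by move=> /(congr1 (mulmx S)); rewrite mulKVmx // mulmx0.
have kerMX q (v : 'cV_n) : M ^+ q.+1 *m v = 0 -> M *m v = 0.
  elim: q => [|q IHq]; first by rewrite expr1.
  by rewrite !exprS -!mulmxE -!mulmxA => /kerM;
    rewrite mulmxA mulmxE -exprS => /IHq.
have Mj : M *m (delta_mx j 0 : 'cV_n) != 0.
  apply: contraNneq Uij => /matrixP/(_ i 0).
  by rewrite -colE !mxE (negPf neq_ij) mulr0n subr0 => ->.
(* [M] pushes vectors of the generalized eigenspace strictly downwards. *)
have supp q (k : 'I_n) : (M ^+ q *m (delta_mx j 0 : 'cV_n)) k 0 != 0 ->
    U k k = l /\ (q <= k)%N.
  elim: q k => [|q IHq] k.
    rewrite expr0 -idmxE mul1mx mxE eqxx andbT.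
    by case: (eqVneq k j) => [->|_] /=; [rewrite -(bU _ _ Uij) | rewrite eqxx].
  rewrite exprS -mulmxE -mulmxA mxE => nz.
  have [m] : exists m, M k m * (M ^+ q *m (delta_mx j 0 : 'cV_n)) m 0 != 0.
    apply: contrapT => nex; move/eqP: nz; apply; apply: big1 => m _.
    by apply/eqP; apply: contrapT => nzm; apply: nex; exists m; apply/negP.
  rewrite mulf_eq0 negb_or => /andP[nzM /IHq[Um le_qm]].
  have neq_km : k != m.
    by apply: contraNneq nzM => ->; rewrite !mxE Um eqxx mulr1n subrr.
  have nzU : U k m != 0 by move: nzM; rewrite !mxE (negPf neq_km) mulr0n subr0.
  split; first by rewrite (bU _ _ nzU).
  rewrite (leq_ltn_trans le_qm) // ltn_neqAle eq_sym neq_km /= leqNgt.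
  by apply: contra nzU => lt_km; move/is_trig_mxP: tU => ->.
(* The support of [M ^+ n.+1 *m delta_mx j 0] would consist of indices greater than [n], and there
   are none. *)
case/eqP: Mj; apply: (kerMX n); apply/matrixP => k z; rewrite ord1 [RHS]mxE.
apply: contraTeq isT => nz; have [_] := supp _ _ nz.
by rewrite leqNgt ltnS ltnW.
Qed.

(** * Operator norm *)

Lemma modulus_ge0 (R : realType) (z : R[i]) : 0 <= modulus z.
Proof. by case: z => a b; apply: sqrtr_ge0. Qed.
#[local] Hint Extern 0 (is_true (0 <= modulus _)) => exact: modulus_ge0 : core.

Lemma modulus_real (R : realType) (x : R) : modulus x%:C = `|x|.
Proof. by rewrite /= expr0n addr0 sqrtr_sqr. Qed.

Lemma modulusX (R : realType) (z : R[i]) (p : nat) :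
  modulus (z ^+ p) = modulus z ^+ p.
Proof.
elim: p => [|p IHp]; first exact: Normc.normc1.
by rewrite !exprS Normc.normcM IHp.
Qed.

Lemma modulus_sum (R : realType) (I : Type) (s : seq I) (F : I -> R[i]) :
  modulus (\sum_(k <- s) F k) <= \sum_(k <- s) modulus (F k).
Proof.
elim/big_ind2: _ => [|x1 x2 y1 y2 le1 le2|//]; first by rewrite Normc.normc0.
by rewrite (le_trans (le_normcD _ _)) // lerD.
Qed.

(** Weighted Cauchy-Schwarz: twice the difference of the two sides is the double sum of
    [a k * a m * (x k - x m) ^+ 2]. *)
Lemma sqr_sum_weighted_le (R : realFieldType) (I : finType) (a x : I -> R) :
  (forall k, 0 <= a k) ->
  (\sum_k a k * x k) ^+ 2 <= (\sum_k a k) * (\sum_k a k * x k ^+ 2).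
Proof.
move=> a0; rewrite expr2 -(ler_pM2r (ltr0Sn R 1)) !mulr_natr.
rewrite [X in _ <= X]mulr2n [X in _ <= _ + X]mulrC !big_distrlr /=.
rewrite -!sumrMnl -!big_split /=.
apply: ler_sum => k _; rewrite -sumrMnl -big_split; apply: ler_sum => m _ /=.
rewrite -subr_ge0; have -> : a k * (a m * x m ^+ 2) + a k * x k ^+ 2 * a m
    - (a k * x k * (a m * x m)) *+ 2 = a k * a m * (x k - x m) ^+ 2 by ring.
by rewrite mulr_ge0 ?sqr_ge0 ?mulr_ge0.
Qed.

Lemma sqr_l2norm (R : realType) (n : nat) (v : 'cV[R[i]]_n) :
  l2norm v ^+ 2 = \sum_k modulus (v k 0) ^+ 2.
Proof. by rewrite sqr_sqrtr // sumr_ge0 // => k _; apply: sqr_ge0. Qed.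

Lemma l2norm_ge0 (R : realType) (n : nat) (v : 'cV[R[i]]_n) : 0 <= l2norm v.
Proof. exact: sqrtr_ge0. Qed.
#[local] Hint Extern 0 (is_true (0 <= l2norm _)) => exact: l2norm_ge0 : core.

Lemma modulus_le_l2norm (R : realType) (n : nat) (v : 'cV[R[i]]_n) (k : 'I_n) :
  modulus (v k 0) <= l2norm v.
Proof.
rewrite -(@ler_pXn2r _ 2) ?nnegrE // sqr_l2norm (bigD1 k) //= lerDl.
by rewrite sumr_ge0 // => m _; apply: sqr_ge0.
Qed.

Lemma l2norm_eq0 (R : realType) (n : nat) (v : 'cV[R[i]]_n) :
  l2norm v = 0 -> v = 0.
Proof.
move=> v0; apply/matrixP => k z; rewrite ord1 mxE; apply: Normc.eq0_normc.
by apply/eqP; rewrite eq_le modulus_ge0 -v0 modulus_le_l2norm.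
Qed.

Lemma l2norm0 (R : realType) (n : nat) : l2norm (0 : 'cV[R[i]]_n) = 0.
Proof.
rewrite /l2norm big1 ?sqrtr0 // => k _.
by rewrite mxE Normc.normc0 expr0n.
Qed.

Lemma l2normZ (R : realType) (n : nat) (z : R[i]) (v : 'cV[R[i]]_n) :
  l2norm (z *: v) = modulus z * l2norm v.
Proof.
apply/eqP; rewrite -(@eqrXn2 _ 2) ?mulr_ge0 //.
rewrite exprMn !sqr_l2norm mulr_sumr; apply/eqP/eq_bigr => k _.
by rewrite mxE Normc.normcM exprMn.
Qed.

(** Schur test: Cauchy-Schwarz with the weights [modulus (T i j)] uses the row sums; exchanging the
    two summations then uses the column sums. *)
Lemma l2norm_mulmx_schur (R : realType) (n : nat) (T : 'M[R[i]]_n) (a : R) :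
  0 <= a -> (forall i, \sum_j modulus (T i j) <= a) ->
  (forall j, \sum_i modulus (T i j) <= a) ->
  forall v : 'cV_n, l2norm (T *m v) <= a * l2norm v.
Proof.
move=> a0 rowT colT v; rewrite -(@ler_pXn2r _ 2) ?nnegrE ?mulr_ge0 //.
rewrite exprMn !sqr_l2norm; apply: le_trans
  (_ : \sum_i a * (\sum_j modulus (T i j) * modulus (v j 0) ^+ 2) <= _).
  apply: ler_sum => i _; apply: le_trans (_ : (\sum_j modulus (T i j)) *
      (\sum_j modulus (T i j) * modulus (v j 0) ^+ 2) <= _); last first.
    by rewrite ler_wpM2r // sumr_ge0 // => j _; rewrite mulr_ge0 ?sqr_ge0.
  apply: le_trans (sqr_sum_weighted_le _ _) => //.
  rewrite ler_pXn2r ?nnegrE ?sumr_ge0 // => [|j _]; last by rewrite mulr_ge0.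
  rewrite mxE (le_trans (modulus_sum _ _)) //.
  by apply: ler_sum => j _; rewrite Normc.normcM.
rewrite -mulr_sumr expr2 -mulrA ler_wpM2l // exchange_big mulr_sumr /=.
by apply: ler_sum => j _; rewrite -mulr_suml ler_wpM2r ?sqr_ge0.
Qed.

Lemma l2norm_mulmx (R : realType) (n : nat) (T : 'M[R[i]]_n) (v : 'cV_n) :
  l2norm (T *m v) <= opnorm T * l2norm v.
Proof.
have [v0|nzv] := eqVneq (l2norm v) 0.
  by rewrite v0 (l2norm_eq0 v0) mulmx0 l2norm0 mulr0.
have lv : 0 < l2norm v by rewrite lt_def nzv l2norm_ge0.
rewrite -ler_pdivrMr // mulrC -[X in X * _]ger0_norm ?invr_ge0 //.
rewrite -modulus_real -l2normZ scalemxAr; apply: sup_upper_bound.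
  split; first by exists (l2norm (T *m 0)), 0 => //=; rewrite l2norm0.
  (* The supremum dominates its set only if the set is bounded; the sum of the moduli of all entries
     is a crude bound. *)
  pose a := \sum_i \sum_j modulus (T i j).
  have a0 : 0 <= a by rewrite sumr_ge0 // => i _; rewrite sumr_ge0.
  exists a => _ [w /= w1 <-].
  apply: le_trans (l2norm_mulmx_schur a0 _ _ _) _ => [i|j|].
  - rewrite /a [leRHS](bigD1 i) //= lerDl !sumr_ge0 // => k _.
    by rewrite sumr_ge0.
  - rewrite /a exchange_big [leRHS](bigD1 j) //= lerDl !sumr_ge0 // => k _.
    by rewrite sumr_ge0.
  - by rewrite ler_piMr.
exists ((l2norm v)^-1%:C *: v) => //=.
by rewrite l2normZ modulus_real ger0_norm ?invr_ge0 // mulVf.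
Qed.

Lemma opnorm_le (R : realType) (n : nat) (T : 'M[R[i]]_n) (a : R) :
  0 <= a -> (forall v : 'cV_n, l2norm (T *m v) <= a * l2norm v) ->
  opnorm T <= a.
Proof.
move=> a0 Ta; apply: ge_sup.
  by exists (l2norm (T *m 0)), 0 => //=; rewrite l2norm0.
by move=> _ [v /= v1 <-]; rewrite (le_trans (Ta v)) // ler_piMr.
Qed.

Lemma modulus_le_opnorm (R : realType) (n : nat) (T : 'M[R[i]]_n) (i j : 'I_n) :
  modulus (T i j) <= opnorm T.
Proof.
have e1 : l2norm (delta_mx j 0 : 'cV[R[i]]_n) = 1.
  rewrite /l2norm (bigD1 j) //= big1 => [|k /negPf nk].
    by rewrite addr0 mxE !eqxx Normc.normc1 expr1n sqrtr1.
  by rewrite mxE nk Normc.normc0 expr0n.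
have := l2norm_mulmx T (delta_mx j 0); rewrite e1 mulr1; apply: le_trans.
by rewrite -colE (le_trans _ (modulus_le_l2norm _ i)) // mxE.
Qed.

Lemma opnorm_ge0 (R : realType) (n : nat) (T : 'M[R[i]]_n) : 0 <= opnorm T.
Proof.
case: n T => [|n] T; last exact: le_trans (modulus_le_opnorm T 0 0).
(* In dimension 0 there is no entry to compare with, and the value at the zero vector is used
   instead. *)
have := @sup_upper_bound R
  [set l2norm (T *m v) | v in [set v : 'cV_0 | l2norm v <= 1]].
rewrite -/(opnorm T) => ub; rewrite -(l2norm0 R 0); apply: ub.
  split; first by exists (l2norm (T *m 0)), 0 => //=; rewrite l2norm0.
  by exists 0 => _ [w _ <-]; rewrite [T *m w]flatmx0 l2norm0.
by exists 0; rewrite /= ?mulmx0 ?l2norm0.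
Qed.
#[local] Hint Extern 0 (is_true (0 <= opnorm _)) => exact: opnorm_ge0 : core.

Lemma opnormM (R : realType) (n : nat) (S T : 'M[R[i]]_n) :
  opnorm (S *m T) <= opnorm S * opnorm T.
Proof.
apply: opnorm_le => [|v]; first exact: mulr_ge0.
rewrite -mulmxA (le_trans (l2norm_mulmx _ _)) // -mulrA.
by rewrite ler_wpM2l // l2norm_mulmx.
Qed.

Lemma opnormZ_le (R : realType) (n : nat) (c : R) (T : 'M[R[i]]_n) :
  0 <= c -> opnorm (c%:C *: T) <= c * opnorm T.
Proof.
move=> c0; apply: opnorm_le => [|v]; first exact: mulr_ge0.
rewrite -scalemxAl l2normZ modulus_real ger0_norm // -mulrA.
by rewrite ler_wpM2l // l2norm_mulmx.
Qed.

Lemma opnormZ (R : realType) (n : nat) (c : R) (T : 'M[R[i]]_n) :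
  0 < c -> opnorm (c%:C *: T) = c * opnorm T.
Proof.
move=> c0; apply/eqP; rewrite eq_le (opnormZ_le _ (ltW c0)) /= -ler_pdivlMl //.
(* The reverse inequality is [opnormZ_le] for the scalar [c^-1] and the matrix [c%:C *: T]. *)
rewrite -[T in leLHS](scalerK (_ : c%:C != 0)); last first.
  by rewrite fmorph_eq0 gt_eqF.
by rewrite -fmorphV /= opnormZ_le // invr_ge0 ltW.
Qed.

Lemma opnorm_schur (R : realType) (n : nat) (T : 'M[R[i]]_n) (a : R) :
  0 <= a -> (forall i, \sum_j modulus (T i j) <= a) ->
  (forall j, \sum_i modulus (T i j) <= a) -> opnorm T <= a.
Proof.
by move=> a0 rowT colT; apply: opnorm_le => //; apply: l2norm_mulmx_schur.
Qed.

Lemma opnorm_diag_mx (R : realType) (n : nat) (d : 'rV[R[i]]_n) (a : R) :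
  0 <= a -> (forall k, modulus (d 0 k) <= a) -> opnorm (diag_mx d) <= a.
Proof.
move=> a0 da; apply: opnorm_schur => // k; rewrite (bigD1 k) //= big1.
- by rewrite addr0 mxE eqxx mulr1n.
- by move=> m nm; rewrite mxE eq_sym (negPf nm) mulr0n Normc.normc0.
- by rewrite addr0 mxE eqxx mulr1n.
- by move=> m nm; rewrite mxE (negPf nm) mulr0n Normc.normc0.
Qed.

(** If [f k] is the only nonzero term, the bound 1 on it suffices. As soon as another term is
    nonzero, [f k] drops to at most [r], and the other terms together stay below [n%:R * d]. *)
Lemma sum_le1 (R : realFieldType) (n : nat) (f : 'I_n -> R) (k : 'I_n)
    (r d : R) :
  0 <= d -> n%:R * d <= 1 - r -> f k <= 1 ->
  (forall m, m != k -> f m != 0 -> f k <= r /\ f m <= d) ->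
  \sum_m f m <= 1.
Proof.
move=> d0 nd fk1 fd; rewrite (bigD1 k) //=.
have [[m nm fm]|nex] := pselect (exists2 m, m != k & f m != 0).
  have [fkr _] := fd m nm fm.
  have : \sum_(m | m != k) f m <= n%:R * d.
    rewrite mulr_natl -[X in _ *+ X]card_ord -sumr_const.
    rewrite [leRHS](bigD1 k) //= -[leLHS]add0r lerD //; apply: ler_sum => p np.
    by have [->//|/(fd p np)[]] := eqVneq (f p) 0.
  by move=> le_sum; rewrite (le_trans (lerD fkr le_sum)) // -lerBrDl.
rewrite big1 ?addr0 // => m nm; apply: contrapT => /eqP fm; apply: nex.
by exists m.
Qed.

(** A nonzero off-diagonal entry at [i], [j] counts in row [i] and in column [j], which is why both
    [V i i] and [V j j] must be at most [r] in modulus. *)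
Lemma opnorm_le1_almost_diag (R : realType) (n : nat) (V : 'M[R[i]]_n)
    (r d : R) :
  0 <= d -> n%:R * d <= 1 - r -> (forall k, modulus (V k k) <= 1) ->
  (forall i j, i != j -> V i j != 0 ->
     [/\ modulus (V i i) <= r, modulus (V j j) <= r & modulus (V i j) <= d]) ->
  opnorm V <= 1.
Proof.
move=> d0 nd V1 Vd; have nz (z : R[i]) : modulus z != 0 -> z != 0.
  by apply: contraNneq => ->; rewrite Normc.normc0.
apply: opnorm_schur => // k;
  apply: (sum_le1 (k := k) (r := r) (d := d)) => // m nm /nz Vnz.
  by rewrite eq_sym in nm; have [] := Vd _ _ nm Vnz.
by have [] := Vd _ _ nm Vnz.
Qed.

(** * Eigenvalues of power bounded matrices *)

Lemma arithmetic_unbounded (R : realType) (c D : R) :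
  (forall p : nat, p%:R * c <= D) -> c <= 0.
Proof.
move=> bc; rewrite leNgt; apply/negP => c0.
have := bc (Num.bound `|D / c|); apply/negP; rewrite -ltNge -ltr_pdivrMr //.
by rewrite (le_lt_trans (ler_norm _)) // archi_boundP.
Qed.

(** The Bernoulli inequality reduces geometric growth to linear growth. *)
Lemma geometric_bounded_le1 (R : realType) (x c D : R) :
  0 <= x -> 0 < c -> (forall p : nat, x ^+ p.+1 * c <= D) -> x <= 1.
Proof.
move=> x0 c0 bx; rewrite -subr_le0.
apply: (@arithmetic_unbounded _ _ (D / c)) => p.
have bern q : 1 + q%:R * (x - 1) <= x ^+ q.
  elim: q => [|q IHq]; first by rewrite mul0r addr0 expr0.
  have := ler_wpM2l x0 IHq; rewrite -exprS; apply: le_trans; rewrite -subr_ge0.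
  have -> : x * (1 + q%:R * (x - 1)) - (1 + q.+1%:R * (x - 1)) =
      q%:R * (x - 1) ^+ 2 by rewrite -natr1; ring.
  by rewrite mulr_ge0 // sqr_ge0.
have := bx p; rewrite -ler_pdivlMr // => /(le_trans (bern p.+1)); apply: le_trans.
have -> : 1 + p.+1%:R * (x - 1) = x + p%:R * (x - 1) by rewrite -natr1; ring.
by rewrite lerDr.
Qed.

Lemma power_bounded_coord (R : realType) (n : nat) (T : 'M[R[i]]_n) :
  power_bounded T ->
  exists C : R, forall p i j, modulus ((T ^+ p.+1) i j) <= C.
Proof.
move=> [C _ TC]; exists C => p i j.
exact: le_trans (modulus_le_opnorm _ _ _) (TC p.+1 isT).
Qed.

(** For a row eigenvector [v], [v *m T ^+ p = l ^+ p *: v]; at a nonzero coordinate of [v], bounded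
    powers of [T] give bounded powers of [l]. *)
Lemma power_bounded_eigenvalue (R : realType) (n : nat) (T : 'M[R[i]]_n)
    (l : R[i]) :
  power_bounded T -> eigenvalue T l -> modulus l <= 1.
Proof.
move=> /power_bounded_coord[C TC] /eigenvalueP[v vT nzv].
have /rV0Pn[k vk] := nzv.
apply: (@geometric_bounded_le1 _ _ (modulus (v 0 k))
  (\sum_m modulus (v 0 m) * C)) => //.
  rewrite lt_def modulus_ge0 andbT; apply: contra_neq vk; exact: Normc.eq0_normc.
move=> p; have vTp q : v *m T ^+ q = l ^+ q *: v.
  elim: q => [|q IHq]; first by rewrite !expr0 -idmxE mulmx1 scale1r.
  by rewrite !exprSr -mulmxE mulmxA IHq -scalemxAl vT scalerA.
rewrite -modulusX -Normc.normcM.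
have -> : l ^+ p.+1 * v 0 k = (v *m T ^+ p.+1) 0 k by rewrite vTp mxE.
rewrite mxE (le_trans (modulus_sum _ _)) // ler_sum // => m _.
by rewrite Normc.normcM ler_wpM2l.
Qed.

(** The strict inequality is what makes the denominator [1 - max_Delta F] positive. *)
Lemma power_bounded_Delta (R : realType) (n : nat) (T : 'M[R[i]]_n)
    (l : R[i]) :
  power_bounded T -> Delta T l -> modulus l < 1.
Proof.
move=> pbT [eigl neqK].
rewrite lt_neqAle (power_bounded_eigenvalue pbT eigl) andbT.
apply/eqP => l1; apply: neqK; apply/seteqP; split=> v;
  rewrite /kernel_of /= expr2 -mulmxE -mulmxA.
  by move=> ->; rewrite mulmx0.
(* On [v] the powers of [T] contain the linearly growing term
   [p l^(p-1) w]. *)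
set w := _ *m v => Nw; apply: contrapT => /eqP/cV0Pn[k wk].
have Tv : T *m v = l *: v + w by rewrite /w mulmxBl mul_scalar_mx subrKC.
have Tw : T *m w = l *: w.
  by move/eqP: Nw; rewrite mulmxBl mul_scalar_mx subr_eq0 => /eqP.
have Tpv p : T ^+ p.+1 *m v = l ^+ p.+1 *: v + (p.+1%:R * l ^+ p) *: w.
  elim: p => [|p IHp]; first by rewrite !expr1 expr0 mulr1 scale1r.
  rewrite exprS -mulmxE -mulmxA IHp mulmxDr -!scalemxAr Tv Tw scalerDr !scalerA.
  rewrite -addrA -exprSr -scalerDl; congr (_ + _ *: _).
  by rewrite -[p.+2%:R]natr1 mulrDl mul1r exprSr mulrA addrC.
have [C TC] := power_bounded_coord pbT.
(* As [modulus l = 1], the triangle inequality bounds [p] times [modulus (w k 0)] by the moduli of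
   coordinate [k] of [T ^+ p *m v] and of [v], uniformly in [p]. *)
have : modulus (w k 0) <= 0.
  apply: (@arithmetic_unbounded _ _
    (\sum_m C * modulus (v m 0) + modulus (v k 0))) => -[|p].
    rewrite mul0r addr_ge0 // sumr_ge0 // => m _; rewrite mulr_ge0 //.
    exact: le_trans (modulus_ge0 _) (TC 0%N m m).
  have modl q : modulus (l ^+ q) = 1 by rewrite modulusX l1 expr1n.
  have -> : p.+1%:R * modulus (w k 0) = modulus ((p.+1%:R * l ^+ p) * w k 0).
    rewrite !Normc.normcM modl mulr1 -(rmorph_nat (real_complex R)).
    by rewrite modulus_real ger0_norm.
  have -> : (p.+1%:R * l ^+ p) * w k 0 =
      (T ^+ p.+1 *m v) k 0 + - (l ^+ p.+1 * v k 0).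
    by rewrite Tpv !mxE addrAC subrr add0r.
  rewrite (le_trans (le_normcD _ _)) // lerD //; last first.
    by rewrite normcN Normc.normcM modl mul1r.
  rewrite mxE (le_trans (modulus_sum _ _)) // ler_sum // => m _.
  by rewrite Normc.normcM ler_wpM2r.
rewrite leNgt lt_def modulus_ge0 andbT; case/negP.
by apply: contra_neq wk; exact: Normc.eq0_normc.
Qed.

(** * The similarity *)

Lemma powR_half_pred (R : realType) (x : R) (n : nat) :
  0 <= x -> (0 < n)%N -> x `^ ((n%:R - 1) / 2) = Num.sqrt (x ^+ n.-1).
Proof.
move=> x0 n0; rewrite powRrM powR12_sqrt ?powR_ge0 // -powR_mulrn //.
by rewrite -subn1 natrB.
Qed.

Lemma balance (R : rcfType) (a b : R) :
  0 < a -> 0 < b ->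
  exists2 c : R, 0 < c &
    c * a = Num.sqrt (a * b) /\ c^-1 * b = Num.sqrt (a * b).
Proof.
move=> a0 b0; have sqrtMr (x y : R) : 0 < x -> 0 < y ->
    Num.sqrt (y / x) * x = Num.sqrt (x * y).
  move=> x0 y0; rewrite -[X in _ * X]gtr0_norm // -sqrtr_sqr.
  rewrite -sqrtrM ?divr_ge0 ?(ltW x0) ?(ltW y0) //.
  by congr Num.sqrt; rewrite expr2 mulrA divfK ?gt_eqF // mulrC.
exists (Num.sqrt (b / a)); first by rewrite sqrtr_gt0 divr_gt0.
by rewrite -sqrtrV ?divr_ge0 ?ltW // invf_div !sqrtMr // mulrC.
Qed.

(** Scaling [Z] by [c] and its inverse by [c^-1] changes neither the conjugation nor the product of
    the norms, so both norms can be made equal to their geometric mean. *)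
Lemma balanced_rescaling (R : realType) (n : nat) (Z Z' : 'M[R[i]]_n) :
  (0 < n)%N -> Z *m Z' = 1%:M ->
  exists Y : 'M[R[i]]_n,
    [/\ Y \in unitmx, opnorm Y = Num.sqrt (opnorm Z * opnorm Z'),
        opnorm (invmx Y) = Num.sqrt (opnorm Z * opnorm Z') &
        forall T, Y *m T *m invmx Y = Z *m T *m Z'].
Proof.
(* Positive dimension enters here: the identity has an entry equal to 1, so neither norm can
   vanish. *)
move=> n0 ZZ'; have ge1 : 1 <= opnorm Z * opnorm Z'.
  apply: le_trans (opnormM _ _); rewrite ZZ'.
  apply: le_trans (modulus_le_opnorm _ (Ordinal n0) (Ordinal n0)).
  by rewrite mxE eqxx Normc.normc1.
have Zgt0 : 0 < opnorm Z.
  rewrite lt_def opnorm_ge0 andbT; apply: contraTneq ge1 => ->.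
  by rewrite mul0r -ltNge ltr01.
have Z'gt0 : 0 < opnorm Z'.
  rewrite lt_def opnorm_ge0 andbT; apply: contraTneq ge1 => ->.
  by rewrite mulr0 -ltNge ltr01.
have [c c0 [cZ cZ']] := balance Zgt0 Z'gt0.
have cV : c%:C * c^-1%:C = 1 :> R[i] by rewrite -rmorphM /= divff ?gt_eqF.
have [uY _] : (c%:C *: Z \in unitmx) /\ (c^-1%:C *: Z' \in unitmx).
  by apply: mulmx1_unit; rewrite -scalemxAl -scalemxAr scalerA cV scale1r.
have uZ : Z \in unitmx by have [] := mulmx1_unit ZZ'.
have invZ : invmx Z = Z' by rewrite -[RHS](mulKmx uZ) ZZ' mulmx1.
have uc : c%:C \is a GRing.unit by rewrite unitfE fmorph_eq0 gt_eqF.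
have invY : invmx (c%:C *: Z) = c^-1%:C *: Z' by rewrite invmxZ // invZ -fmorphV.
exists (c%:C *: Z); split; first exact: uY.
- by rewrite (opnormZ Z c0); exact: cZ.
- by rewrite invY opnormZ ?invr_gt0 //; exact: cZ'.
move=> T; rewrite invY -scalemxAr -!scalemxAl scalerA [c^-1%:C * _]mulrC cV.
by rewrite scale1r.
Qed.

Lemma max_Delta_ge0 (R : realType) (n : nat) (F : {fset 'M[R[i]]_n}) :
  0 <= max_Delta F.
Proof. exact: bigmax_ge_id. Qed.

Lemma max_norm_ge0 (R : realType) (n : nat) (F : {fset 'M[R[i]]_n}) :
  0 <= max_norm F.
Proof. exact: bigmax_ge_id. Qed.

Lemma le_max_norm (R : realType) (n : nat) (F : {fset 'M[R[i]]_n}) T :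
  T \in F -> opnorm T <= max_norm F.
Proof.
by move=> FT; apply: (@le_bigmax_seq _ _ _ (enum_fset F) 0 T xpredT).
Qed.

Lemma le_max_Delta (R : realType) (n : nat) (F : {fset 'M[R[i]]_n}) T l :
  T \in F -> Delta T l -> modulus l <= max_Delta F.
Proof.
move=> FT Tl; rewrite /max_Delta.
apply: (@bigmax_sup_seq _ _ _ (enum_fset F) 0 T xpredT) => //.
apply: (@le_bigmax_seq _ _ _ (enum_fset (fset_set (Delta T))) 0 l xpredT) => //.
change (l \in fset_set (Delta T)).
by rewrite in_fset_set ?inE //; exact: finite_Delta.
Qed.

Lemma max_Delta_lt1 (R : realType) (n : nat) (F : {fset 'M[R[i]]_n}) :
  (forall T, T \in F -> power_bounded T) -> max_Delta F < 1.
Proof.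
move=> pbF; rewrite /max_Delta big_seq; apply: bigmax_lt => // T FT.
rewrite big_seq; apply: bigmax_lt => // l.
rewrite in_fset_set ?inE; last exact: finite_Delta.
exact: power_bounded_Delta (pbF T FT).
Qed.

(** The quotient of [max_norm F] by the maximum will bound the entries below the diagonal; the
    inequality is the smallness that [opnorm_le1_almost_diag] asks for, and follows from
    [n <= n ^ 2]. *)
Lemma similarity_ratio_bound (R : realType) (n : nat) (F : {fset 'M[R[i]]_n}) :
  max_Delta F < 1 ->
  n%:R * (max_norm F / Num.max 1 (similarity_ratio F)) <= 1 - max_Delta F.
Proof.
move=> r1; set K := max_norm F; set r := max_Delta F in r1 *.
set M := Num.max 1 _; have M0 : 0 < M by rewrite lt_max ltr01.
have K0 : 0 <= K := max_norm_ge0 F.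
rewrite mulrA ler_pdivrMr //; apply: le_trans (_ : n%:R ^+ 2 * K <= _).
  by rewrite ler_wpM2r // -natrX ler_nat; case: (n) => // m; rewrite leq_pmulr.
by rewrite [leRHS]mulrC -ler_pdivrMr ?subr_gt0 // /M le_max lexx orbT.
Qed.

(** [Y] is the balanced multiple of [D *m S]. Under the square root, one factor [kappa] pays for [S]
    and its inverse, and [n - 1] factors [kappa * M] pay for [D']. *)
Lemma contraction_similarity (R : realType) (n : nat) (S : 'M[R[i]]_n)
    (F : {fset 'M[R[i]]_n}) (kappa : R) :
  (0 < n)%N -> S \in unitmx -> 1 <= kappa ->
  opnorm S * opnorm (invmx S) <= kappa ->
  (forall T, T \in F -> power_bounded T) ->
  (forall T, T \in F -> exists2 U, S *m T = U *m S & block_triangular U) ->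
  exists Y : 'M[R[i]]_n,
    [/\ Y \in unitmx,
        forall T, T \in F -> mx_contraction (Y *m T *m invmx Y),
        opnorm Y = opnorm (invmx Y) &
        opnorm Y <= Num.sqrt (kappa ^+ n) *
          Num.max 1 (similarity_ratio F) `^ ((n%:R - 1) / 2)].
Proof.
move=> n0 uS k1 Sk pbF SF; set M := Num.max 1 _.
have M1 : 1 <= M by rewrite le_max lexx.
have [k0 M0] : 0 < kappa /\ 0 < M by split; apply: lt_le_trans ltr01 _.
(* The factor [kappa] in [e] compensates for the bound [kappa * max_norm F] on [opnorm U]; the
   maximum with 1 in [M] guarantees [e <= 1]. *)
have r1 := max_Delta_lt1 pbF; pose e := (kappa * M)^-1.
have e0 : 0 < e by rewrite invr_gt0 mulr_gt0.
have e1 : e <= 1 by rewrite invf_le1 ?mulr_gt0 // mulr_ege1.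
pose D : 'M[R[i]]_n := diag_mx (\row_k (e ^+ k)%:C).
pose D' : 'M[R[i]]_n := diag_mx (\row_k (e ^- k)%:C).
have eV (k : nat) : (e ^+ k)%:C * (e ^- k)%:C = 1 :> R[i].
  by rewrite -rmorphM /= divff ?expf_neq0 ?gt_eqF.
have DD' : D *m D' = 1%:M.
  rewrite mulmx_diag -diag_const_mx; congr diag_mx.
  by apply/matrixP => i j; rewrite !mxE eV.
have D1 : opnorm D <= 1.
  apply: opnorm_diag_mx => // k; rewrite mxE modulus_real.
  rewrite ger0_norm ?exprn_ge0 ?(ltW e0) //.
  by rewrite exprn_ile1 // ltW.
have D'1 : opnorm D' <= (kappa * M) ^+ n.-1.
  apply: opnorm_diag_mx => [|k]; first by rewrite exprn_ge0 // mulr_ge0 ?ltW.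
  rewrite mxE modulus_real ger0_norm ?invr_ge0 ?exprn_ge0 ?(ltW e0) //.
  rewrite -exprVn invrK ler_weXn2l ?mulr_ege1 //.
  by rewrite -ltnS prednK.
have [Y [uY normY normY' conjY]] : exists Y : 'M[R[i]]_n,
    [/\ Y \in unitmx,
        opnorm Y = Num.sqrt (opnorm (D *m S) * opnorm (invmx S *m D')),
        opnorm (invmx Y) = Num.sqrt (opnorm (D *m S) * opnorm (invmx S *m D')) &
        forall T, Y *m T *m invmx Y = D *m S *m T *m (invmx S *m D')].
  by apply: balanced_rescaling => //; rewrite -mulmxA (mulmxA S) mulmxV // mul1mx.
exists Y; split; [exact: uY|move=> T FT| |]; last 2 first.
- by rewrite normY'; exact: normY.
- rewrite normY powR_half_pred ?(ltW M0) //.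
  rewrite -sqrtrM ?exprn_ge0 ?(ltW k0) // ler_wsqrtr //.
  have -> : kappa ^+ n * M ^+ n.-1 = kappa * (kappa * M) ^+ n.-1.
    by rewrite exprMn mulrA -exprS prednK.
  apply: le_trans (ler_pM _ _ (opnormM _ _) (opnormM _ _)) _ => //.
  rewrite -mulrA [X in _ * X]mulrA mulrA; apply: ler_pM => //; last first.
  - by rewrite -[leRHS]mul1r ler_pM ?mulr_ge0.
  - by rewrite !mulr_ge0.
have [U ST bU] := SF T FT; have [tU diagU] := bU.
have YTY' : Y *m T *m invmx Y = D *m U *m D'.
  by rewrite conjY -(mulmxA D S T) ST !mulmxA mulmxK.
have YTY'E i j : (Y *m T *m invmx Y) i j = (e ^+ i)%:C * U i j * (e ^- j)%:C.
  by rewrite YTY' mul_mx_diag mul_diag_mx !mxE.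
have diagY i : (Y *m T *m invmx Y) i i = U i i by rewrite YTY'E mulrAC eV mul1r.
have opU : opnorm U <= kappa * max_norm F.
  have -> : U = S *m T *m invmx S by rewrite ST mulmxK.
  rewrite (le_trans (opnormM _ _)) // mulrC.
  apply: le_trans (ler_wpM2l _ (opnormM _ _)) _ => //.
  by rewrite mulrA [_ * opnorm S]mulrC ler_pM ?mulr_ge0 ?le_max_norm.
apply: (@opnorm_le1_almost_diag _ _ _ (max_Delta F) (max_norm F / M)).
- by rewrite divr_ge0 ?max_norm_ge0 ?ltW.
- exact: similarity_ratio_bound.
- move=> k; rewrite diagY; apply: power_bounded_eigenvalue (pbF T FT) _.
  exact: similar_eigenvalue uS ST (trig_mx_eigenvalue k tU).
move=> i j neq_ij Vij; have Uij : U i j != 0.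
  by apply: contraNneq Vij; rewrite YTY'E => ->; rewrite mulr0 mul0r.
have le_r : modulus (U i i) <= max_Delta F.
  exact: le_max_Delta FT (off_diag_Delta uS ST bU neq_ij Uij).
rewrite !diagY -(diagU i j Uij) YTY'E; split=> //.
have lt_ji : (j < i)%N.
  rewrite ltn_neqAle eq_sym neq_ij /= leqNgt.
  by apply: contra Uij => lt_ij; move/is_trig_mxP: tU => ->.
rewrite !Normc.normcM !modulus_real !ger0_norm ?invr_ge0 ?exprn_ge0 ?(ltW e0) //.
(* As [j < i] and [e <= 1], the scaling [e ^+ (i - j)] is at most [e], and [e * kappa] equals
   [M^-1]. *)
rewrite mulrAC -expfB //; apply: le_trans (_ : e * (kappa * max_norm F) <= _).
  apply: ler_pM; rewrite ?exprn_ge0 ?(ltW e0) //.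
    by rewrite -[leRHS]expr1 ler_wiXn2l ?(ltW e0) // subn_gt0.
  exact: le_trans (modulus_le_opnorm _ _ _) opU.
by rewrite /e invfM mulrACA [_^-1 * _]mulVf ?gt_eqF // mul1r mulrC.
Qed.

(** Since [n ^ 2 / (1 - r)] is at least 1, the ratio is at least [opnorm T], hence at least [b^-1];
    the factor [b] therefore absorbs the maximum with 1. *)
Lemma max1_similarity_ratio_le (R : realType) (n : nat) (F : {fset 'M[R[i]]_n})
    (T : 'M[R[i]]_n) (b : R) :
  (0 < n)%N -> 1 <= b -> max_Delta F < 1 -> T \in F -> b^-1 <= opnorm T ->
  Num.max 1 (similarity_ratio F) <= b * similarity_ratio F.
Proof.
move=> n0 b1 r1 FT bT; have b0 : 0 < b by apply: lt_le_trans b1.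
have le_bF : b^-1 <= similarity_ratio F.
  apply: le_trans bT (le_trans (le_max_norm FT) _).
  rewrite ler_pdivlMr ?subr_gt0 // [leRHS]mulrC ler_wpM2l ?max_norm_ge0 //.
  apply: le_trans (_ : 1 <= _); first by rewrite gerBl max_Delta_ge0.
  by rewrite exprn_ege1 // ler1n.
have F0 : 0 <= similarity_ratio F by apply: le_trans le_bF; rewrite invr_ge0 ltW.
by rewrite ge_max ler_peMl // andbT -ler_pdivrMl // mulr1.
Qed.

Theorem theorem4p2 (R : realType) (n : nat) (hn : (0 < n)%N)
    (A : set 'M[R[i]]_n)
    (hcomm : commuting A)
    (hpb : forall T : 'M[R[i]]_n, A T -> power_bounded T) :
  exists2 alpha : R, 1 <= alpha &
    forall F : {fset 'M[R[i]]_n}, (forall T : 'M[R[i]]_n, T \in F -> A T) ->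
    exists Y : 'M[R[i]]_n,
      [/\ Y \in unitmx,
          forall T : 'M[R[i]]_n, T \in F -> mx_contraction (Y *m T *m invmx Y),
          opnorm Y = opnorm (invmx Y),
          opnorm Y <=
            alpha * Num.max 1 (similarity_ratio F) `^ ((n%:R - 1) / 2)
        & F != fset0 -> norms_bounded_below A ->
          opnorm Y <= alpha * similarity_ratio F `^ ((n%:R - 1) / 2)].
Proof.
(* The whole space is invariant. A single [S] for all of [A] is what keeps [alpha] independent of
   [F]. *)
have [S uS AS] : exists2 S : 'M[R[i]]_n, S \in unitmx &
    forall T, A T -> exists2 U, S *m T = U *m S & block_triangular U.
  have [|k [S [fS eqS AS]]] := stable_triangular_basis hcomm (B := 1%:M).
    by move=> T _; rewrite submx1.
  have eq_kn : k = n by rewrite -(eqP fS) eqS mxrank1.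
  by subst k; exists S; rewrite // -row_free_unit.
pose kappa := Num.max 1 (opnorm S * opnorm (invmx S)).
have kappa1 : 1 <= kappa by rewrite le_max lexx.
pose e : R := (n%:R - 1) / 2.
have e0 : 0 <= e by rewrite divr_ge0 // subr_ge0 ler1n.
(* [b] depends on [A] alone; if the norms are not bounded below, the implication is vacuous and 1
   will do. *)
have [b b1 Ab] : exists2 b : R, 1 <= b &
    norms_bounded_below A -> forall T, A T -> b^-1 <= opnorm T.
  have [[delta delta0 Ad]|?] := pselect (norms_bounded_below A); last by exists 1.
  exists (Num.max 1 delta^-1) => [|_ T AT]; first by rewrite le_max lexx.
  apply: le_trans (Ad T AT); rewrite invf_ple ?posrE ?lt_max ?ltr01 //.
  by rewrite le_max lexx orbT.
have be1 : 1 <= b `^ e by rewrite -(powRr0 b) ler_powR.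
have sk1 : 1 <= Num.sqrt (kappa ^+ n) by rewrite -sqrtr1 ler_wsqrtr // exprn_ege1.
(* The left factor comes from [contraction_similarity]. The power of [b] is at least 1, so it is
   harmless in the first bound; in the second it pays for removing the maximum with 1. *)
exists (Num.sqrt (kappa ^+ n) * b `^ e); first exact: mulr_ege1.
move=> F FA; have pbF T : T \in F -> power_bounded T by move=> /FA/hpb.
have [||Y [uY Ycontr normY leY]] := contraction_similarity hn uS kappa1 _ pbF.
- by rewrite le_max lexx orbT.
- by move=> T /FA/AS.
exists Y; split; [exact: uY | exact: Ycontr | exact: normY | |].
  apply: le_trans leY _; rewrite -mulrA ler_wpM2l ?sqrtr_ge0 //.
  by rewrite ler_peMl // powR_ge0.
case/fset0Pn=> T FT nbA; apply: le_trans leY _; rewrite -mulrA.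
rewrite ler_wpM2l ?sqrtr_ge0 //.
have b0 : 0 <= b := le_trans ler01 b1.
have le_ratio := max1_similarity_ratio_le hn b1 (max_Delta_lt1 pbF) FT
  (Ab nbA T (FA T FT)).
have ratio0 : 0 <= similarity_ratio F.
  by rewrite !mulr_ge0 ?max_norm_ge0 // invr_ge0 subr_ge0 ltW // max_Delta_lt1.
rewrite -powRM //; apply: ge0_ler_powR => //.
- by rewrite nnegrE le_max ler01.
- by rewrite nnegrE mulr_ge0.
Qed.
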